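(* Let $\beta \in S_n$, let $\beta_j$ be an $m$-cycle in the disjoint cycle decomposition of $\beta$, let $\alpha \in S_n$, and let $k \geq 1$. Then $\alpha$ $(k,\beta)$-commutes with $\beta_j$ if and only if $\alpha\beta_j\alpha^{-1} = (P_1 \dots P_k)$ for blocks $P_1,\dots,P_k$ satisfying: (1) if $k=1$, then $P_1$ is a proper block in a cycle of $\beta$; (2) if $k>1$, then $P_1,\dots,P_k$ are $k$ pairwise disjoint blocks, from one or more cycles of $\beta$, such that for every $i \in [k]$ the string $P_iP_{i+1 \bmod k}$ is not a block in any cycle of $\beta$.
   Context: $S_n$ is the symmetric group on $[n]=\{1,\dots,n\}$; products are composed right to left ($\alpha\beta$ means first $\beta$, then $\alpha$). Cycles of a permutation include its fixed points as $1$-cycles. The convention $m \bmod m = m$ is used. For a cycle $(a_1 a_2 \dots a_m)$ of a permutation, a block is a string $a_ia_{i+1}\dots a_{i+l-1}$ of $l$ consecutive entries of the cycle, $1 \le l \le m$, indices taken modulo $m$; its length is $l$; it is proper if $l<m$ and improper if $l=m$. Two blocks are disjoint if they share no point; the product of disjoint blocks is concatenation of strings. For a cycle $\sigma$ and a string $Q$ (possibly a concatenation of blocks), $\sigma=(Q)$ means that $Q$ is one of the cyclic rotations of the cycle notation of $\sigma$. A point $a$ is a bad commuting point of $\alpha,\beta$ if $\alpha\beta(a)\neq\beta\alpha(a)$. The permutation $\alpha$ $(k,\beta)$-commutes with a cycle $\beta_j$ of $\beta$ if exactly $k$ points of $\beta_j$ are bad commuting points of $\alpha$ and $\beta$. 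*)

(* Defs.v *)
From mathcomp Require Import all_boot all_fingroup.

Set Implicit Arguments.
Unset Strict Implicit.
Unset Printing Implicit Defensive.

Local Open Scope group_scope.

(* The points 1, ..., n are the elements of 'I_n.  Products in the library     *)
(* compose left to right ((s * t) x = t (s x)), so the right-to-left product   *)
(* a s a^-1 is the library's s ^ a, and the right-to-left (a b)(x) is a (b x). *)

Definition is_cyc (n : nat) (s : 'S_n) (C : {set 'I_n}) : bool :=
  (C \in porbits s) && perm_on C s.

(* A cycle carries its set of points, because a 1-cycle (x) is not determined  *)
(* by its permutation, which is the identity.                                  *)
Record cyc (n : nat) := Cyc {
  cyc_perm : 'S_n;
  cyc_pts : {set 'I_n};
  cycP : is_cyc cyc_perm cyc_pts
}.

Definition cyc_length (n : nat) (sigma : cyc n) : nat := #|cyc_pts sigma|.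

Definition cyc_in (n : nat) (beta : 'S_n) (sigma : cyc n) : Prop :=
  cyc_pts sigma \in porbits beta /\
  {in cyc_pts sigma, cyc_perm sigma =1 beta}.

Lemma is_cycJ (n : nat) (s a : 'S_n) (C : {set 'I_n}) :
  is_cyc s C -> is_cyc (s ^ a) (a @: C).
Proof.
case/andP=> /imsetP[x _ ->] onC; apply/andP; split.
  apply/imsetP; exists (a x) => //; apply/setP=> y.
  apply/imsetP/porbitP=> [[z /porbitP[i ->] ->] | [i ->]].
    by exists i; rewrite -conjXg permJ.
  by exists ((s ^+ i) x); rewrite ?mem_porbit // -conjXg permJ.
apply/subsetP=> y; rewrite inE -{1 2}(permKV a y) permJ => neq.
rewrite -(permKV a y) imset_f //; apply: (subsetP onC).
by rewrite inE; apply: contraNneq neq => ->.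
Qed.

Definition cycJ (n : nat) (a : 'S_n) (sigma : cyc n) : cyc n :=
  Cyc (is_cycJ a (cycP sigma)).

(* sigma = (Q): the choice of the starting point x ranges over all the cyclic  *)
(* rotations of the cycle notation of sigma.                                   *)
Definition cyc_notation (n : nat) (sigma : cyc n) (Q : seq 'I_n) : Prop :=
  exists2 x, x \in cyc_pts sigma &
    Q = traject (cyc_perm sigma) x (cyc_length sigma).

Definition is_block (n : nat) (sigma : cyc n) (Q : seq 'I_n) : Prop :=
  exists (c : seq 'I_n) (i l : nat),
    [/\ cyc_notation sigma c, i < size c, 0 < l <= size c
      & Q = take l (rot i c)].

Definition is_proper_block (n : nat) (sigma : cyc n) (Q : seq 'I_n) : Prop :=
  is_block sigma Q /\ size Q < cyc_length sigma.

Definition bad_commuting (n : nat) (alpha beta : 'S_n) (a : 'I_n) : bool :=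
  alpha (beta a) != beta (alpha a).

Definition kcommutes (n k : nat) (alpha beta : 'S_n) (betaj : cyc n) : Prop :=
  #|[set a in cyc_pts betaj | bad_commuting alpha beta a]| = k.

(* Main.v *)
Require Import Defs.
From mathcomp Require Import all_boot all_fingroup.

Set Implicit Arguments.
Unset Strict Implicit.
Unset Printing Implicit Defensive.

(* Put e x y := (beta x == y) and g = alpha betaj alpha^-1.  Blocks of beta    *)
(* are the nonempty duplicate-free e-chains, and a point a of betaj is bad     *)
(* exactly when beta and g disagree at alpha a.  Cutting the cycle g at the    *)
(* points where it disagrees with beta gives the P_i: inside each P_i the two  *)
(* permutations agree, and they disagree at its last point because P_i P_(i+1) *)
(* is not an e-chain.  A single block P_1 is proper exactly when P_1 P_1 is    *)
(* not an e-chain, so k = 1 is not special.                                    *)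

(** Both directions reduce to one count on a cyclic word. Going round the cycle [g], each point is
    or is not followed by its image under [beta]; the failures are the images under [alpha] of the
    bad points ([card_bad_commuting]). Cutting after each failure yields chains with a break at
    every junction ([split_chains]). Conversely, any cyclic factorization of [g] into such chains
    has one failure per factor ([count_disagree_cycle]). [is_blockP] and [is_proper_blockP]
    translate chains and breaks into blocks. *)

Section Chains.

Variable T : eqType.

Definition chain_break (e : rel T) (P Q : seq T) : bool := ~~ sorted e (P ++ Q).

Lemma chain_break_sub (e : rel T) (P P' Q Q' : seq T) :
  chain_break e P Q -> chain_break e (P' ++ P) (Q ++ Q').
Proof.
apply: contra; rewrite -catA => /cat_sorted2[_].
by rewrite catA => /cat_sorted2[].
Qed.

(** Induction from the right: a new letter joins the first chain if the link holds and otherwise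
    stands alone. The one-letter string [[:: y]] stands for the start of the next lap, so the last
    chain also gets a break. *)
Lemma split_chains (e : rel T) (x y : T) (p : seq T) :
    ~~ e (last x p) y ->
  exists q QQ, [/\ flatten ((x :: q) :: QQ) = x :: p,
    all (sorted e) ((x :: q) :: QQ)
    & path (chain_break e) (x :: q) (rcons QQ [:: y])].
Proof.
elim: p x => [|z p IH] x /= brk.
  by exists [::], [::]; split; rewrite //= /chain_break /= !andbT.
have [q [QQ [flat chains brks]]] := IH z brk.
have [exz | nexz] := boolP (e x z).
  exists (z :: q), QQ; split; first by rewrite -flat.
    by move: chains => /= /andP[-> ->]; rewrite exz.
  case: QQ brks {flat chains} => [|R QQ] /= /andP[brk1 brks];
    apply/andP; split=> //;
    by have := chain_break_sub [:: x] [::] brk1; rewrite cats0.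
exists [::], ((z :: q) :: QQ); split; first by rewrite -flat.
  by rewrite /= in chains *.
by rewrite rcons_cons /= in brks *; rewrite brks /chain_break /= (negPf nexz).
Qed.

(** The break forces both strings to be nonempty. Inside [P] both maps give the next letter; the
    only link of [P ++ Q] that can fail for [f] is the junction, where [g] still holds, so they
    disagree exactly at the last letter of [P]. *)
Lemma count_disagree_chain (f g : T -> T) (P Q : seq T) :
    sorted (frel f) P -> sorted (frel f) Q -> chain_break (frel f) P Q ->
    sorted (frel g) (P ++ Q) ->
  count (fun x => f x != g x) P = 1.
Proof.
rewrite /chain_break.
case: P => [|x p] /=; first by move=> _ ->.
case: Q => [|y q]; first by rewrite cats0 => ->.
rewrite !cat_path /= => fp fq; rewrite fp fq andbT /= => brk /and3P[gp /eqP gy _].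
elim: p x fp brk gp gy => [|z p IH] x /=; first by move=> _ /[swap] _ /[swap] -> ->.
move=> /andP[/eqP fx fp] brk /andP[/eqP gx gp] gy.
by rewrite fx gx eqxx add0n IH.
Qed.

Lemma count_disagree_chains (f g : T -> T) (P : seq T) (PP : seq (seq T))
    (R : seq T) :
    all (sorted (frel f)) (P :: PP) -> sorted (frel f) R ->
    path (chain_break (frel f)) P (rcons PP R) ->
    sorted (frel g) (flatten (P :: PP) ++ R) ->
  count (fun x => f x != g x) (flatten (P :: PP)) = (size PP).+1.
Proof.
elim: PP P => [|Q PP IH] P.
  rewrite /= !andbT cats0; exact: count_disagree_chain.
rewrite rcons_cons -![flatten [:: P, Q & PP]]/(P ++ flatten (Q :: PP)).
move=> /= /andP[fP chains] fR /andP[brk brks] sg.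
rewrite count_cat -[Q ++ flatten PP]/(flatten (Q :: PP)) IH //.
  rewrite (@count_disagree_chain f g P Q) //; first by case/andP: chains.
  by move: sg; rewrite -!catA catA => /cat_sorted2[].
by move: sg; rewrite -catA => /cat_sorted2[].
Qed.

(** Opens a cycle into a linear word, so that the first factor can serve as the successor of the
    last one. *)
Lemma cycle_cat_sorted (e : rel T) (p q : seq T) :
  path.cycle e (p ++ q) -> sorted e (p ++ q ++ p).
Proof.
case: p => [|x p].
  by case: q => [|y q]; rewrite //= cats0 rcons_path => /andP[].
by rewrite /= rcons_cat !cat_path /= rcons_path => /and3P[-> -> ->].
Qed.

Lemma count_disagree_cycle (f g : T -> T) (PP : seq (seq T)) :
    all (sorted (frel f)) PP -> path.cycle (chain_break (frel f)) PP ->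
    fcycle g (flatten PP) ->
  count (fun x => f x != g x) (flatten PP) = size PP.
Proof.
case: PP => // P PP chains brks /cycle_cat_sorted.
rewrite catA => sg; apply: count_disagree_chains sg => //.
by case/andP: chains.
Qed.

Lemma cycle_tnthP (k : nat) (r : rel T) (t : k.-tuple T) :
  reflect (forall i, r (tnth t i) (tnth t (ordS i))) (path.cycle r t).
Proof.
case: k t => [|k] t; first by rewrite tuple0; constructor; case.
case/tupleP: t => x p /=.
have nthS (i : nat) : i < k.+1 ->
    nth x (rcons p x) i = nth x (x :: p) (i.+1 %% k.+1).
  rewrite ltnS leq_eqVlt => /predU1P[-> | ltik].
    by rewrite modnn nth_rcons size_tuple ltnn eqxx.
  by rewrite modn_small ?ltnS // nth_rcons size_tuple ltik.
apply: (iffP (pathP x)) => [r_p i | r_t i].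
  have lti : i < size (rcons p x) by rewrite size_rcons size_tuple.
  have := r_p i lti; rewrite !(tnth_nth x) /=.
  by rewrite nthS // -rcons_cons nth_rcons /= size_tuple ltn_ord.
rewrite size_rcons size_tuple => lti.
rewrite nthS // -rcons_cons nth_rcons /= size_tuple lti.
by have := r_t (Ordinal lti); rewrite !(tnth_nth x).
Qed.

Lemma uniq_flatten_disjoint (k : nat) (P : k.-tuple (seq T)) (i j : 'I_k) (x : T) :
  uniq (flatten P) -> i != j -> x \in tnth P i -> x \notin tnth P j.
Proof.
suff lt_case (a b : 'I_k) : uniq (flatten P) -> a < b ->
    x \in tnth P a -> x \notin tnth P b.
  move=> uP; rewrite neq_ltn => /orP[]; first exact: lt_case.
  by move=> ltji xi; apply/negP=> /(lt_case _ _ uP ltji); rewrite xi.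
(* Cut the word before factor [b]: factor [a] lies to the left, factor [b] to the right. *)
rewrite -{1}(cat_take_drop b P) flatten_cat cat_uniq => /and3P[_ /hasPn dis _].
move=> ltab xa; apply/negP => xb; have /dis/negP[] : x \in flatten (drop b P).
  apply/flattenP; exists (tnth P b) => //.
  rewrite (tnth_nth [::]) -[X in nth _ _ X]addn0 -nth_drop mem_nth //.
  by rewrite size_drop size_tuple subn_gt0.
apply/flattenP; exists (tnth P a) => //.
rewrite (tnth_nth [::]) -(nth_take _ ltab) mem_nth //.
by rewrite size_takel ?size_tuple // ltnW.
Qed.

Lemma uniq_flatten_mem (ss : seq (seq T)) (s : seq T) :
  uniq (flatten ss) -> s \in ss -> uniq s.
Proof.
move=> + /path.splitPr s_in; case: s_in => s1 s2.
by rewrite flatten_cat cat_uniq /= cat_uniq => /and4P[_ _ ->].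
Qed.

End Chains.

(** * Blocks of [beta] as duplicate-free chains *)

Section Blocks.

Variable n : nat.
Implicit Types (s beta : 'S_n) (sigma : cyc n) (c Q : seq 'I_n).

Lemma mem_porbit_perm s x y : (s y \in porbit s x) = (y \in porbit s x).
Proof. by rewrite porbit_sym -{2}(expg1 s) porbit_perm porbit_sym. Qed.

Lemma cyc_notationP sigma c :
    cyc_notation sigma c ->
  [/\ uniq c, c =i cyc_pts sigma, size c = cyc_length sigma
    & fcycle (cyc_perm sigma) c].
Proof.
case: sigma => s C isC [x /= xC ->]; rewrite /cyc_length /=.
have {isC xC} -> : C = porbit s x.
  case/andP: isC => /imsetP[y _ Cy] _; rewrite Cy in xC *.
  by apply/eqP; rewrite eq_sym eq_porbit_mem.
split; [exact: uniq_traject_porbit | | exact: size_traject | ].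
  by move=> y; rewrite -porbit_traject.
have := iter_porbit s x; case: #|porbit s x| => [|l] //= sx.
by apply/fpathP; exists l.+1; rewrite trajectSr -iterSr /= sx.
Qed.

Lemma fcycle_cyc_in beta sigma c :
    cyc_in beta sigma -> c =i cyc_pts sigma ->
  fcycle (cyc_perm sigma) c = fcycle beta c.
Proof.
case=> _ eqs c_pts; apply: (@eq_in_cycle _ [in cyc_pts sigma]).
  by move=> x y xC _ /=; rewrite eqs.
by apply/allP=> x; rewrite c_pts.
Qed.

Lemma is_block_fcycle beta sigma Q :
    cyc_in beta sigma -> is_block sigma Q ->
  0 < size Q /\ exists R, [/\ uniq (Q ++ R), fcycle beta (Q ++ R)
                            & size (Q ++ R) = cyc_length sigma].
Proof.
move=> in_beta [c [i [l [/cyc_notationP[uc c_pts szc cyc_c] _ /andP[l0 lec] ->]]]].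
split; first by rewrite size_takel ?size_rot.
exists (drop l (rot i c)).
by rewrite cat_take_drop rot_uniq rot_cycle size_rot -(fcycle_cyc_in in_beta).
Qed.

(** For the converse, a chain is a trajectory of [beta] from its first point [x]. Having no
    repetition, it is no longer than the orbit of [x], so it is a prefix of the cycle notation
    starting at [x]. *)
Lemma is_blockP beta Q :
  (exists2 sigma, cyc_in beta sigma & is_block sigma Q) <->
  [/\ 0 < size Q, uniq Q & sorted (frel beta) Q].
Proof.
split=> [[sigma in_beta /(is_block_fcycle in_beta)[Q0 [R [+ /cycle_cat_sorted]]]] | []].
  by rewrite cat_uniq => /and3P[uQ _ _] /cat_sorted2[].
case: Q => // x q _ uQ /fpathE Eq.
set C := porbit beta x.
have stabC : beta \in ('N(C | 'P))%g.
  by apply/astabsP=> y /=; rewrite apermE mem_porbit_perm.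
pose s := restr_perm C beta.
have sE : {in C, s =1 beta} by move=> y Cy; apply: restr_permE.
have sXE (i : nat) : (s ^+ i)%g x = (beta ^+ i)%g x.
  by elim: i => [|i IH]; rewrite ?expg0 // !expgSr !permM IH sE ?mem_porbit.
have Cs : porbit s x = C.
  by apply/setP=> y; apply/porbitP/porbitP=> -[i ->]; exists i; rewrite sXE.
have isC : is_cyc s C by rewrite /is_cyc restr_perm_on -Cs imset_f.
exists (Cyc isC); first by split; [exact: imset_f | exact: sE].
have trajE l : traject s x l = traject beta x l.
  by apply: (@eq_from_nth _ x) => [|i]; rewrite !size_traject // => lti;
     rewrite !nth_traject // -!permX sXE.
have Q_traj : x :: q = traject beta x (size q).+1 by rewrite /= -Eq.
have szQ : size (x :: q) <= #|C|.
  rewrite -(card_uniqP uQ); apply/subset_leq_card/subsetP => y.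
  by rewrite Q_traj => /trajectP[i _ ->]; rewrite -permX mem_porbit.
exists (traject beta x #|C|), 0, (size (x :: q)).
rewrite size_traject szQ rot0 take_traject //; split=> //.
  by exists x; rewrite /cyc_length //= ?trajE ?porbit_id.
by rewrite (leq_trans _ szQ).
Qed.

(** If [Q] is the whole cycle, it closes up on itself. Otherwise its last point is sent to a point
    outside [Q], hence not to its head. *)
Lemma proper_blockE beta sigma Q :
    cyc_in beta sigma -> is_block sigma Q ->
  (size Q < cyc_length sigma) = chain_break (frel beta) Q Q.
Proof.
move=> in_beta /(is_block_fcycle in_beta)[Q0 [[|y R] []]].
  rewrite cats0 => _ cycQ <-; rewrite ltnn; apply/esym/negbF.
  by have := @cycle_cat_sorted _ _ Q [::]; rewrite cats0 => /(_ _ cycQ).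
rewrite size_cat addnS => uQ /cycle_cat_sorted; rewrite catA => /cat_sorted2[+ _] <-.
rewrite ltnS leq_addr; case: Q Q0 uQ => // x q _ uQ.
rewrite /= cat_path /= => /and3P[_ /eqP lastQ _].
apply/esym; rewrite /chain_break /= cat_path /= lastQ.
apply/negP=> /and3P[_ /eqP yx _].
by move: uQ; rewrite cat_uniq yx /= inE eqxx /= andbF.
Qed.

Lemma is_proper_blockP beta Q :
  (exists2 sigma, cyc_in beta sigma & is_proper_block sigma Q) <->
  [/\ uniq Q, sorted (frel beta) Q & chain_break (frel beta) Q Q].
Proof.
split=> [[sigma in_beta [blkQ]] | [uQ chQ brk]].
  rewrite (proper_blockE in_beta blkQ) => brk.
  by have /is_blockP[_ uQ chQ] : exists2 s, cyc_in beta s & is_block s Q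
    by exists sigma.
have /is_blockP[sigma in_beta blkQ] :
    [/\ 0 < size Q, uniq Q & sorted (frel beta) Q].
  by split=> //; case: (Q) brk.
by exists sigma => //; split; rewrite // (proper_blockE in_beta blkQ).
Qed.

(** The bijection is [alpha]: the conjugated cycle sends [alpha a] to [alpha (beta a)]. *)
Lemma card_bad_commuting beta sigma (alpha : 'S_n) c :
    cyc_in beta sigma -> cyc_notation (cycJ alpha sigma) c ->
  #|[set a in cyc_pts sigma | bad_commuting alpha beta a]| =
  count (fun x => beta x != cyc_perm (cycJ alpha sigma) x) c.
Proof.
case=> _ eqs /cyc_notationP[uc c_pts _ _].
rewrite -size_filter -(card_uniqP (filter_uniq _ uc)).
rewrite -(card_imset _ (@perm_inj _ alpha)); apply: eq_card => y.
rewrite -(permKV alpha y) mem_imset; last exact: perm_inj.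
rewrite mem_filter c_pts inE /= mem_imset; last exact: perm_inj.
rewrite permJ andbC /bad_commuting eq_sym.
by apply: andb_id2r => aC; rewrite eqs.
Qed.

End Blocks.

(** * The equivalence *)

Theorem theorem2 (n m : nat) (beta : 'S_n) (betaj : cyc n)
    (beta_betaj : cyc_in beta betaj) (betaj_m : cyc_length betaj = m)
    (alpha : 'S_n) (k : nat) (k_ge1 : 1 <= k) :
  kcommutes k alpha beta betaj <->
  exists P : k.-tuple (seq 'I_n),
    [/\ cyc_notation (cycJ alpha betaj) (flatten P),
        k = 1 ->
          forall i : 'I_k,
            exists2 sigma, cyc_in beta sigma & is_proper_block sigma (tnth P i)
      & 1 < k ->
          [/\ forall i : 'I_k,
                exists2 sigma, cyc_in beta sigma & is_block sigma (tnth P i),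
              forall i j : 'I_k, i != j ->
                [disjoint tnth P i & tnth P j]
            & forall i : 'I_k,
                ~ (exists2 sigma, cyc_in beta sigma
                   & is_block sigma (tnth P i ++ tnth P (ordS i)))]].
Proof.
set g := cycJ alpha betaj.
have ordS_neq (i : 'I_k) : 1 < k -> i != ordS i.
  move=> k_gt1; rewrite -val_eqE /=; have := ltn_ord i.
  rewrite -[i < k]/(i.+1 <= k) leq_eqVlt => /predU1P[Ek | ltk].
    by rewrite Ek modnn; apply: contraTneq k_gt1 => i0; rewrite -Ek i0.
  by rewrite modn_small // neq_ltn leqnn.
split=> [badk | [P [notP prop1 propk]]].
  have /set0Pn[a] : [set a in cyc_pts betaj | bad_commuting alpha beta a] != set0.
    by rewrite -card_gt0 badk.
  rewrite inE => /andP[aC bad_a].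
  (* Start the notation of [g] just after the disagreement at [alpha a], so that the seam of the
     word is a genuine break. *)
  pose x := alpha (betaj.(cyc_perm) a).
  have gC : x \in cyc_pts g.
    rewrite imset_f //; case: (betaj) aC => s C /= /andP[/imsetP[y _ ->] _] aC.
    by rewrite mem_porbit_perm.
  have not_c : cyc_notation g (traject (cyc_perm g) x (cyc_length g)) by exists x.
  have [uc c_pts szc cyc_c] := cyc_notationP not_c.
  case Ec: (traject _ _ _) => [|x' p] in not_c uc c_pts szc cyc_c.
    by rewrite -c_pts in gC.
  have {}Ec : x' = x by move: Ec; case: cyc_length => //= l [].
  rewrite {x'}Ec in not_c uc c_pts szc cyc_c.
  have last_c : last x p = alpha a.
    move: cyc_c; rewrite /= rcons_path => /andP[_ /eqP gl].
    by apply: (@perm_inj _ (cyc_perm g)); rewrite gl /= permJ.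
  have brk : ~~ frel beta (last x p) x.
    rewrite /= last_c; move: bad_a; rewrite /bad_commuting eq_sym /x.
    by rewrite (proj2 beta_betaj).
  have [q [QQ [flat chains brks]]] := split_chains (e := frel beta) brk.
  pose PP := (x :: q) :: QQ.
  have brkPP : path.cycle (chain_break (frel beta)) PP.
    move: brks; rewrite /= !rcons_path => /andP[-> /= brkl].
    (* The break before [[:: x]] persists when that string is extended to the first chain, which
       closes the cycle. *)
    by rewrite -[last _ _]cat0s -(cat1s x q); apply: chain_break_sub.
  have szPP : size PP == k.
    rewrite -badk (card_bad_commuting beta_betaj not_c) -[_ :: _]flat.
    by rewrite count_disagree_cycle // [flatten _]flat.
  pose P := Tuple szPP.
  have uP : uniq (flatten P) by rewrite [flatten _]flat.
  have chP i : sorted (frel beta) (tnth P i) by apply: (all_tnthP (t := P)).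
  have brkP i : chain_break (frel beta) (tnth P i) (tnth P (ordS i)).
    exact: (cycle_tnthP _ P brkPP).
  have uPi i : uniq (tnth P i) by apply: uniq_flatten_mem uP (mem_tnth _ _).
  exists P; split; first by rewrite [flatten _]flat.
    move=> k1 i; apply/is_proper_blockP; split=> //.
    have {2}-> // : i = ordS i.
    by apply/val_inj; case: i => i /=; rewrite k1 modn1; case: i.
  move=> k_gt1; split=> [i | i j neq | i /is_blockP[_ _ ch]].
  - apply/is_blockP; split=> //.
    (* An empty factor could not break against its successor, which is a chain. *)
    by have := brkP i; case: (tnth P i) => //; rewrite /chain_break /= chP.
  - apply/pred0P=> y /=; apply/andP=> -[yi].
    exact/negP/(uniq_flatten_disjoint _ neq).
  - by have := brkP i; rewrite /chain_break ch.
have [uP _ _ cycP] := cyc_notationP notP.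
rewrite /kcommutes (card_bad_commuting beta_betaj notP).
rewrite count_disagree_cycle ?size_tuple //.
  apply/all_tnthP=> i; case: (ltngtP k 1) => [| k_gt1 | k1].
  - by rewrite ltnNge k_ge1.
  - by have [/(_ i)/is_blockP[]] := propk k_gt1.
  - by have /is_proper_blockP[] := prop1 k1 i.
apply/cycle_tnthP=> i; case: (ltngtP k 1) => [| k_gt1 | k1].
- by rewrite ltnNge k_ge1.
- have [blk dis nblk] := propk k_gt1.
  (* If the junction were a chain, it would be a block: it is duplicate-free because the indices [i]
     and [ordS i] differ for [k > 1]. *)
  apply/negP=> ch; apply: (nblk i); apply/is_blockP; split=> //.
    by have /is_blockP[+ _ _] := blk i; rewrite size_cat; case: (size _).
  have /is_blockP[_ ui _] := blk i; have /is_blockP[_ uj _] := blk (ordS i).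
  rewrite cat_uniq ui uj andbT; apply/hasPn=> y yj; apply/negP=> yi.
  by have /pred0P/(_ y)/= := dis _ _ (ordS_neq i k_gt1); rewrite yi yj.
have <- : i = ordS i.
  by apply/val_inj; case: i => i /=; rewrite k1 modn1; case: i.
by have /is_proper_blockP[] := prop1 k1 i.
Qed.
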